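(* For every integer $n \ge 3$ there exists a smooth lattice polytope $P \subset \mathbb{R}^n$ of dimension $n$ such that, writing its Ehrhart polynomial as $i(P,t)=\sum_{j=0}^n c_j t^j$, the coefficient $c_j$ is negative for every $j = 1, \ldots, n-2$.
   Context: A lattice polytope is the convex hull of finitely many points of $\mathbb{Z}^n$. An $n$-dimensional lattice polytope $P\subset\mathbb{R}^n$ is smooth if each vertex lies in exactly $n$ edges and the primitive edge directions at each vertex form a basis of the lattice $\mathbb{Z}^n$. The Ehrhart polynomial $i(P,t)$ is the unique polynomial with $i(P,t)=|tP\cap\mathbb{Z}^n|$ for all integers $t>0$; it has degree $\dim P$. *)

(* Defs.v *)
From HB Require Import structures.
From mathcomp Require Import all_boot all_order all_algebra.
From mathcomp Require Import all_classical all_reals.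

Set Implicit Arguments.
Unset Strict Implicit.
Unset Printing Implicit Defensive.

Import Order.TTheory GRing.Theory Num.Theory.

Local Open Scope classical_set_scope.
Local Open Scope ring_scope.

Definition int_point (R : realType) (n : nat) (z : 'rV[int]_n) : 'rV[R]_n :=
  map_mx intr z.

Definition conv_hull (R : realType) (n k : nat) (v : 'I_k -> 'rV[R]_n) :
    set 'rV[R]_n :=
  [set x | exists a : 'I_k -> R,
    [/\ forall i, 0 <= a i, \sum_i a i = 1 & x = \sum_i a i *: v i]].

Definition lattice_polytope (R : realType) (n : nat) (P : set 'rV[R]_n) :=
  exists (k : nat) (v : 'I_k -> 'rV[int]_n),
    P = conv_hull (fun i => int_point R (v i)).

(* A is nonempty and its affine hull is x0 + U with \dim U = d: U is the least
   linear subspace containing A - x0. *)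
Definition has_dim (R : realType) (n : nat) (A : set 'rV[R]_n) (d : nat) :=
  exists (x0 : 'rV[R]_n) (U : {vspace 'rV[R]_n}),
    [/\ A x0,
        forall x, A x -> x - x0 \in U,
        forall W : {vspace 'rV[R]_n},
          (forall x, A x -> x - x0 \in W) -> (U <= W)%VS
      & \dim U = d].

(* f = 0 is allowed, so P and the empty set are faces of P. *)
Definition face (R : realType) (n : nat) (P F : set 'rV[R]_n) :=
  exists (f : {scalar 'rV[R]_n}) (b : R),
    (forall x, P x -> f x <= b) /\ F = [set x | P x /\ f x = b].

Definition vertex (R : realType) (n : nat) (P : set 'rV[R]_n) (v : 'rV[R]_n) :=
  face P [set v].

Definition edge (R : realType) (n : nat) (P E : set 'rV[R]_n) :=
  face P E /\ has_dim E 1.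

Definition primitive (n : nat) (d : 'rV[int]_n) :=
  \big[gcdz/0]_(i < n) d 0 i = 1.

Definition edges_at (R : realType) (n : nat) (P : set 'rV[R]_n)
    (v : 'rV[R]_n) : set (set 'rV[R]_n) :=
  [set E | edge P E /\ E v].

(* For a vertex v, an edge E containing v is a segment with endpoint v, so one
   further point v + t d of E, with t > 0, fixes the ray spanned by d. *)
Definition primitive_edge_directions (R : realType) (n : nat)
    (P : set 'rV[R]_n) (v : 'rV[R]_n) : set 'rV[int]_n :=
  [set d | primitive d /\ exists E, edges_at P v E /\
     exists2 t : R, 0 < t & E (v + t *: int_point R d)].

(* The basis vectors are the rows of B. *)
Definition lattice_basis (n : nat) (D : set 'rV[int]_n) :=
  exists B : 'M[int]_n, D = range (fun i => row i B) /\
    forall z : 'rV[int]_n, exists! c : 'rV[int]_n, z = c *m B.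

Definition smooth (R : realType) (n : nat) (P : set 'rV[R]_n) :=
  forall v, vertex P v ->
    (edges_at P v #= `I_n)%card /\
    lattice_basis (primitive_edge_directions P v).

Definition dilate (R : realType) (n : nat) (t : R) (P : set 'rV[R]_n) :
    set 'rV[R]_n :=
  [set t *: x | x in P].

Definition lattice_points (R : realType) (n : nat) (A : set 'rV[R]_n) :
    set 'rV[int]_n :=
  [set z | A (int_point R z)].

Definition is_ehrhart_poly (R : realType) (n : nat) (P : set 'rV[R]_n)
    (p : {poly R}) :=
  forall t : nat, (0 < t)%N ->
    exists2 N : nat, (lattice_points (dilate t%:R P) #= `I_N)%card
                   & p.[t%:R] = N%:R.

Lemma is_ehrhart_poly_uniq (R : realType) (n : nat) (P : set 'rV[R]_n)
    (p q : {poly R}) :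
  is_ehrhart_poly P p -> is_ehrhart_poly P q -> p = q.
Proof.
move=> hp hq; apply/eqP; rewrite -subr_eq0; apply/negPn/negP => pq0.
set s := [seq (i.+1)%:R : R | i <- iota 0 (size (p - q))].
have us : uniq s.
  rewrite map_inj_uniq ?iota_uniq// => i j /eqP.
  by rewrite eqr_nat => /eqP[].
have rs : all (root (p - q)) s.
  apply/allP => _ /mapP[i _ ->].
  have [N cN pN] := hp i.+1 isT; have [M cM qM] := hq i.+1 isT.
  have NM : N = M.
    by apply/card_eq_II; rewrite -(card_eql cN).
  by rewrite /root hornerD hornerN pN qM NM subrr.
by have := max_poly_roots pq0 rs us; rewrite size_map size_iota ltnn.
Qed.

(* Main.v *)
(* The polytope is a combinatorial cube
     { x | 0 <= x_i <= A_i (1 - x_0) + C_i x_0 },  A_0 = C_0 = 1,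
   whose facet normals at each vertex are unimodular.  Slicing its t-th dilate by
   x_0 = z gives sum_(z <= t) prod_(i <> 0) (A_i (t - z) + C_i z + 1) lattice
   points.  The choice (A_1, C_1) = (d + 1, 1), (A_2, C_2) = (1, d + 1) makes the
   two edges of the rectangular slice vary oppositely: their product contributes
   d^2 z (t - z), whose sum over z is d^2 (t^3 - t) / 6, and this pushes the
   linear coefficient of the 3-dimensional Ehrhart polynomial to -d^2 / 6.  The
   other directions are a cube of side b and multiply that polynomial by
   (1 + b t)^(n - 3); for d >> b >> 0 the negative linear term dominates every
   coefficient of degree 1, ..., n - 2.  Here b = 2^n and d = 6 b, the factor 6
   keeping the coefficients integral. *)
Require Import Defs.
From HB Require Import structures.
From mathcomp Require Import all_boot all_order all_algebra.
From mathcomp Require Import all_classical all_reals.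
From mathcomp Require Import ring lra.

Import Order.TTheory GRing.Theory Num.Theory.
Local Open Scope classical_set_scope.
Local Open Scope ring_scope.

(** * Smoothness at a vertex from a unimodular cone *)

Lemma dvdz_biggcd (I : finType) (F : I -> int) (i : I) :
  (\big[gcdz/0]_j F j %| F i)%Z.
Proof.
have := mem_index_enum i; elim: (index_enum I) => // j s IH.
rewrite inE big_cons => /orP[/eqP ->|/IH]; first exact: dvdz_gcdl.
by apply: dvdz_trans; apply: dvdz_gcdr.
Qed.

(** Faces are cut out by bundled linear forms; naming the form of a column vector lets it carry a
    linear structure. *)
Definition row_form (R : realType) (n : nat) (c : 'cV[R]_n) (x : 'rV[R]_n) : R :=
  (x *m c) 0 0.

Lemma row_form_is_linear (R : realType) (n : nat) (c : 'cV[R]_n) :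
  linear_for *%R (row_form R n c).
Proof. by move=> a x y; rewrite /row_form mulmxDl -scalemxAl !mxE. Qed.

HB.instance Definition _ (R : realType) (n : nat) (c : 'cV[R]_n) :=
  GRing.isLinear.Build R 'rV[R]_n R *%R (row_form R n c)
    (row_form_is_linear R n c).

Section SmoothVertex.
Variables (R : realType) (n : nat) (P : set 'rV[R]_n) (v : 'rV[R]_n).
Variables (B G : 'M[int]_n).
Hypothesis BG : B *m G = 1%:M.
Hypothesis Pv : P v.

Let d i : 'rV[R]_n := int_point R (row i B).
Let g (x : 'rV[R]_n) : 'rV[R]_n := (x - v) *m map_mx intr G.

Hypothesis g_ge0 : forall x k, P x -> 0 <= g x 0 k.
Hypothesis P_step : forall i, exists2 t : R, 0 < t & P (v + t *: d i).

Let E i : set 'rV[R]_n := [set x | P x /\ forall k, k != i -> g x 0 k = 0].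

Let int_pointM (z : 'rV[int]_n) :
  int_point R z *m map_mx intr G = int_point R (z *m G).
Proof. by rewrite /int_point map_mxM. Qed.

Let dG i : d i *m map_mx intr G = delta_mx 0 i.
Proof.
by rewrite int_pointM -row_mul BG /int_point row1 map_delta_mx.
Qed.

Let g_stepE t i k : g (v + t *: d i) 0 k = t * (k == i)%:R.
Proof. by rewrite /g addrC addKr -scalemxAl dG !mxE eqxx. Qed.

Let expand x : x - v = \sum_k g x 0 k *: d k.
Proof.
have GB : G *m B = 1%:M by apply: mulmx1C.
have -> : x - v = g x *m map_mx intr B.
  by rewrite /g -mulmxA -map_mxM GB map_mx1 mulmx1.
by rewrite mulmx_sum_row; apply: eq_bigr => k _; rewrite /d /int_point map_row.
Qed.

Let E_line i x : E i x -> x - v = g x 0 i *: d i.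
Proof.
case=> _ gx; rewrite expand (bigD1 i)//= big1 ?addr0// => k /gx ->.
by rewrite scale0r.
Qed.

Let Ev i : E i v.
Proof. by split=> // k _; rewrite /g subrr mul0mx mxE. Qed.

Let E_step i t : P (v + t *: d i) -> E i (v + t *: d i).
Proof. by move=> Px; split=> // k /negPf ki; rewrite g_stepE ki mulr0. Qed.

Let d_neq0 i : d i != 0.
Proof.
apply/eqP => di; have := dG i; rewrite di mul0mx => /rowP/(_ i)/eqP.
by rewrite !mxE !eqxx eq_sym oner_eq0.
Qed.

Let edge_E i : edge P (E i).
Proof.
split.
  (* Up to a constant, this form is minus the sum of the dual coordinates other than the [i]-th.
     These are nonnegative on [P], so its maximum is attained exactly where they all vanish. *)
  pose c : 'cV[R]_n := map_mx intr G *m (\col_k - (k != i)%:R).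
  have cE x : row_form R n c x = row_form R n c v - \sum_(k | k != i) g x 0 k.
    have cB : row_form R n c (x - v) = - \sum_(k | k != i) g x 0 k.
      rewrite /row_form mulmxA mxE -sumrN [RHS]big_mkcond/=.
      by apply: eq_bigr => k _; rewrite [in X in _ * X]mxE -/(g x);
        case: (k != i); rewrite ?oppr0 ?mulr0 ?mulrN1.
    by rewrite -cB -raddfD addrC subrK.
  exists (row_form R n c), (row_form R n c v); split=> [x Px|].
    by rewrite [leLHS]cE gerBl sumr_ge0// => k _; apply: g_ge0.
  apply/seteqP; split=> x /= [Px gx]; split=> //.
    by rewrite [LHS]cE big1 ?subr0.
  move: gx; rewrite [LHS]cE => /eqP; rewrite -subr_eq0 addrAC subrr add0r oppr_eq0.
  rewrite psumr_eq0; last by move=> k _; apply: g_ge0.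
  by move=> /allP gx k ki; apply/eqP; have := gx k (mem_index_enum _); rewrite ki.
exists v, <[d i]>%VS; split.
- exact: Ev.
- by move=> x /E_line ->; rewrite memvZ// memv_line.
- move=> W EW; rewrite -memvE; have [t t0 /E_step/EW] := P_step i.
  by rewrite addrC addKr => tdW; rewrite -[d i](scalerK (lt0r_neq0 t0)) memvZ.
- by rewrite dim_vline d_neq0.
Qed.

(** A form [f] that defines an edge [F] at [v] is nonpositive on every [d k]. If it vanished on
    none, [F] would reduce to [v] and have dimension 0. So [f (d i) = 0] for some [i]; then [d i]
    lies in the one-dimensional direction space of [F] and spans it, which forces [F = E i]. *)
Let edges_atE : edges_at P v = range E.
Proof.
apply/seteqP; split=> F; last first.
  by case=> i _ <-; split; [exact: edge_E|exact: Ev].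
case=> -[[f [b [fb FE]]] [x0 [U [Fx0 FU Umin dimU]]]] Fv.
have fv : f v = b by move: Fv; rewrite FE => -[].
have fd k : f (d k) <= 0.
  have [t t0 /fb] := P_step k.
  by rewrite linearD linearZ fv gerDl/= pmulr_rle0.
have fE x : f x = b + \sum_k g x 0 k * f (d k).
  rewrite -fv -[in LHS](subrK v x) addrC linearD expand linear_sum/=.
  by congr (_ + _); apply: eq_bigr => k _; rewrite linearZ.
have FvU x : F x -> x - v \in U.
  move=> Fx; have -> : x - v = (x - x0) - (v - x0) by rewrite opprB addrA subrK.
  by rewrite memvB ?FU.
have [i fi] : exists i, f (d i) = 0.
  apply: contrapT => /forallNP fn0.
  have : (U <= 0)%VS.
    have xv x : F x -> x = v.
      rewrite FE => -[Px]; rewrite fE => /eqP.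
      rewrite -subr_eq0 addrAC subrr add0r -oppr_eq0 -sumrN psumr_eq0.
        move=> /allP gx; apply/eqP; rewrite -subr_eq0 expand; apply/eqP.
        apply: big1 => k _; have := gx k (mem_index_enum _).
        rewrite /= oppr_eq0 mulf_eq0 => /orP[/eqP -> |/eqP /fn0//].
        by rewrite scale0r.
      by move=> k _; rewrite -mulrN mulr_ge0 ?oppr_ge0 ?fd ?g_ge0.
    by apply: Umin => x /xv ->; rewrite (xv _ Fx0) subrr mem0v.
  by move=> /dimvS; rewrite dimU dimv0.
have F_step t k : f (d k) = 0 -> P (v + t *: d k) -> F (v + t *: d k).
  by move=> fk Pk; rewrite FE; split=> //; rewrite linearD linearZ/= fk mulr0 addr0.
have UE : U = <[d i]>%VS.
  apply/esym/eqP; rewrite eqEdim dimU dim_vline d_neq0 andbT -memvE.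
  have [t t0 /(F_step _ _ fi)/FvU] := P_step i.
  by rewrite addrC addKr => tdW; rewrite -[d i](scalerK (lt0r_neq0 t0)) memvZ.
exists i => //; apply/seteqP; split=> x.
  move=> Ex; rewrite FE; case: (Ex) => Px _; split=> //.
  by rewrite -(subrK v x) (E_line _ _ Ex) linearD linearZ/= fi mulr0 add0r.
move=> Fx; have := FvU x Fx; rewrite UE => /vlineP[c xv].
by rewrite -(subrK v x) xv addrC; apply: E_step; rewrite addrC -xv subrK;
  move: Fx; rewrite FE => -[].
Qed.

Let E_inj : injective E.
Proof.
move=> i j Eij; apply/eqP/negP => /negP ij.
have [t t0 /E_step] := P_step i; rewrite Eij => -[_ /(_ i ij)].
by rewrite g_stepE eqxx mulr1 => t00; rewrite t00 ltxx in t0.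
Qed.

(** A direction [z] along [E i] is an integer multiple [c] of row [i] of [B]; [c] is nonnegative
    because [P] lies in the cone, and divides the gcd of the entries of [z], so primitivity gives
    [c = 1]. Conversely, the gcd of row [i] divides the diagonal entry 1 of [B *m G]. *)
Let directionsE : primitive_edge_directions P v = range (fun i => row i B).
Proof.
apply/seteqP; split=> z.
  case=> pz [F []]; rewrite edges_atE => -[i _ <-{F}] [t t0 [Pz gz]].
  have gzE k : g (v + t *: int_point R z) 0 k = t * ((z *m G) 0 k)%:~R.
    by rewrite /g addrC addKr -scalemxAl int_pointM !mxE.
  have zG k : k != i -> (z *m G) 0 k = 0.
    move=> /gz; rewrite gzE => /eqP; rewrite mulf_eq0 gt_eqF//=.
    by rewrite intr_eq0 => /eqP.
  have zE : z = (z *m G) 0 i *: row i B.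
    have GB : G *m B = 1%:M by apply: mulmx1C.
    rewrite -[LHS]mulmx1 -GB mulmxA mulmx_sum_row (bigD1 i)//= big1 ?addr0//.
    by move=> k /zG ->; rewrite scale0r.
  have : 0 <= (z *m G) 0 i.
    by have := g_ge0 _ i Pz; rewrite gzE pmulr_rge0// ler0z.
  move: zE; set c := (z *m G) 0 i => zE c0.
  have : (c %| 1)%Z.
    rewrite -[1%Z]/(1 : int) -pz; elim/big_rec: _ => [|k y _ cy]; first exact: dvdz0.
    by rewrite dvdz_gcd cy andbT zE mxE dvdz_mulr.
  rewrite dvdz1 => /eqP c1; exists i => //.
  by rewrite [RHS]zE -[c]gez0_abs// c1 scale1r.
case=> i _ <-; split; last first.
  by have [t t0 Pt] := P_step i; exists (E i); rewrite edges_atE; split;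
    [exists i|exists t => //; apply: E_step].
rewrite /primitive; set c := \big[_/_]_(_ < n) _.
have : (c %| 1)%Z.
  have /matrixP/(_ i i) := BG; rewrite !mxE eqxx => BGi; rewrite -[1%Z]/(true%:R : int) -BGi.
  elim/big_rec: _ => [|k y _ cy]; first exact: dvdz0.
  apply: rpredD => //; apply: dvdz_mulr; have <- : row i B 0 k = B i k by rewrite mxE.
  exact: (dvdz_biggcd _ (fun k => row i B 0 k)).
have : 0 <= c by rewrite /c; elim/big_rec: _.
by rewrite dvdz1 => c0 /eqP c1; rewrite -[c]gez0_abs// c1.
Qed.

(* [B] lists the edge directions at [v] and [G] the dual basis: [P] lies in the
   cone at [v] where all coordinates of [(x - v) *m G] are nonnegative. *)
Lemma unimodular_cone_smooth :
  (edges_at P v #= `I_n)%card /\ lattice_basis (primitive_edge_directions P v).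
Proof.
split.
  rewrite edges_atE (card_eqr card_II); apply: inj_card_eq => i j _ _; exact: E_inj.
exists B; split; first exact: directionsE.
move=> z; exists (z *m G); split.
  by rewrite -mulmxA (mulmx1C BG) mulmx1.
by move=> c ->; rewrite -mulmxA BG mulmx1.
Qed.

End SmoothVertex.

(** * Convex hulls and their vertices *)

Lemma sumr_delta (R : pzRingType) (I : finType) (i : I) (F : I -> R) :
  \sum_j (j == i)%:R * F j = F i.
Proof.
rewrite (bigD1 i)//= eqxx mul1r big1 ?addr0// => j /negPf ->.
by rewrite mul0r.
Qed.

Lemma conv_hull_point (R : realType) (n k : nat) (v : 'I_k -> 'rV[R]_n) j :
  conv_hull v (v j).
Proof.
exists (fun i => (i == j)%:R); split=> [i||]; first exact: ler0n.
  by rewrite -[RHS](sumr_delta R _ j (fun=> 1)); apply: eq_bigr => i _; rewrite mulr1.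
rewrite (bigD1 j)//= eqxx scale1r big1 ?addr0// => i /negPf ->.
by rewrite scale0r.
Qed.

(** If a convex combination attains the maximum [b] of [f], the nonnegative terms
    [a i * (b - f (v i))] sum to 0. A generator of nonzero weight therefore lies in the face, which
    is the single point [x]. *)
Lemma vertex_conv_hull (R : realType) (n k : nat) (v : 'I_k -> 'rV[R]_n) x :
  vertex (conv_hull v) x -> exists j, x = v j.
Proof.
case=> f [b [fb xE]].
have [[a [a0 a1 xa]] fx] : conv_hull v x /\ f x = b.
  by have : [set x] x by []; rewrite xE.
have [j aj] : exists j, a j != 0.
  apply: contrapT => /forallNP aN; move: a1; rewrite big1.
    by move=> /esym/eqP; rewrite oner_eq0.
  by move=> i _; apply/eqP/negPn/negP; exact: aN.
have : \sum_i a i * (b - f (v i)) = 0.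
  under eq_bigr do rewrite mulrBr.
  rewrite sumrB -mulr_suml a1 mul1r -fx xa linear_sum -sumrB big1// => i _.
  by rewrite linearZ subrr.
move=> /eqP; rewrite psumr_eq0; last first.
  by move=> i _; rewrite mulr_ge0// subr_ge0 fb//; exact: conv_hull_point.
move=> /allP/(_ j (mem_index_enum _)); rewrite mulf_eq0 (negPf aj)/= subr_eq0.
move=> /eqP bv; exists j; apply/esym.
suff : [set x] (v j) by [].
by rewrite xE; split; [exact: conv_hull_point|].
Qed.

(** * The box: vertices, convex hull, dimension, smoothness *)

Section Box.
Variables (n : nat) (A C : 'I_n.+1 -> nat).

(* Lower facets [x_i = 0]; the height of the upper facet in direction [i]
   moves from [A i] at [x_0 = 0] to [C i] at [x_0 = 1]. *)
Definition box (R : realType) : set 'rV[R]_n.+1 :=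
  [set x | forall i, 0 <= x 0 i <= (A i)%:R * (1 - x 0 0) + (C i)%:R * x 0 0].

(** The bit [e i] chooses between the lower and the upper facet in direction [i]. Once
    [A 0 = C 0 = 1], [e 0] is also the first coordinate, so it selects the height. *)
Definition box_vertex (e : {ffun 'I_n.+1 -> bool}) : 'rV[int]_n.+1 :=
  \row_i ((e i)%:R * (if e 0 then C i else A i)%:R).

Hypotheses (A0 : A 0 = 1%N) (C0 : C 0 = 1%N).
Hypotheses (Apos : forall i, (0 < A i)%N) (Cpos : forall i, (0 < C i)%N).

Let q i : int := (C i)%:R - (A i)%:R.

Let q0 : q 0 = 0. Proof. by rewrite /q A0 C0 subrr. Qed.

Lemma box_vertexE (R : realType) e i : int_point R (box_vertex e) 0 i =
  (e i)%:R * ((A i)%:R + (q i)%:~R * (e 0)%:R).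
Proof.
rewrite !mxE intrM rmorphB/= !mulrz_nat; congr (_ * _).
by case: (e 0); rewrite /= ?mulr1 ?mulr0 ?addr0// addrC subrK.
Qed.

Lemma box_heightE (R : realType) i (z : R) :
  (A i)%:R * (1 - z) + (C i)%:R * z = (A i)%:R + (q i)%:~R * z.
Proof. by rewrite rmorphB/= !mulrz_nat; ring. Qed.

Lemma box_vertex0 (R : realType) e : int_point R (box_vertex e) 0 0 = (e 0)%:R.
Proof. by rewrite box_vertexE q0 A0 mul0r addr0 mulr1. Qed.

Lemma box_vertex_in (R : realType) e : box R (int_point R (box_vertex e)).
Proof.
move=> i; rewrite box_heightE box_vertex0 box_vertexE.
have : 0 <= (A i)%:R + (q i)%:~R * (e 0)%:R :> R.
  by rewrite -box_heightE; case: (e 0); rewrite ?subrr ?subr0 ?mulr0 ?mulr1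
    ?add0r ?addr0 ler0n.
by case: (e i) => /=; rewrite ?mul1r ?mul0r ?lexx// => ->.
Qed.

(** An expectation: the bits [e i] are independent and equal 1 with probability [y i]. Distributing
    the product over the sum leaves a factor [y i] for [i] in [S] and [y i + (1 - y i) = 1]
    elsewhere. *)
Lemma sum_bernoulli (R : comPzRingType) (y : 'I_n.+1 -> R) (S : pred 'I_n.+1) :
  \sum_(e : {ffun 'I_n.+1 -> bool})
    (\prod_i (if e i then y i else 1 - y i)) * \prod_(i | S i) (e i)%:R
  = \prod_(i | S i) y i.
Proof.
pose F i (b : bool) : R := (if b then y i else 1 - y i) * (if S i then b%:R else 1).
transitivity (\sum_(e : {ffun 'I_n.+1 -> bool}) \prod_i F i (e i)).
  by apply: eq_bigr => e _; rewrite big_split/= -big_mkcond.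
rewrite -bigA_distr_bigA/= /F.
rewrite [RHS]big_mkcond; apply: eq_bigr => i _; rewrite big_bool.
by case: (S i); rewrite /= ?mulr1 ?mulr0 ?addr0// addrC subrK.
Qed.

(** A point [x] of the box is the mean of a random vertex whose bits are independent with
    probabilities [y i = x_i / h i], where [h i] is the height above [x_0]. Since [y 0 = x_0],
    coordinate [i != 0] has mean [A_i y_i + q_i y_i y_0 = y_i h_i = x_i]. The case [i = 0] is
    separate, a bit not being independent of itself. *)
Lemma box_conv_hull (R : realType) :
  box R = conv_hull (fun j : 'I_#|{: {ffun 'I_n.+1 -> bool}}| =>
                       int_point R (box_vertex (enum_val j))).
Proof.
apply/seteqP; split=> x; last first.
  case=> a [a0 a1 ->] i; rewrite box_heightE !summxE mulr_sumr.
  (* The constant [A i] is spread over the weights, which sum to 1, so that the inequality can be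
     checked vertex by vertex. *)
  rewrite -[X in _ <= X + _]mulr1 -[X in _ <= _ * X + _]a1 mulr_sumr -big_split/=.
  apply/andP; split.
    apply: sumr_ge0 => j _; rewrite mxE mulr_ge0//.
    by have /andP[] := box_vertex_in R (enum_val j) i.
  have aE j k : (a j *: int_point R (box_vertex (enum_val j))) 0 k =
      a j * int_point R (box_vertex (enum_val j)) 0 k by rewrite mxE.
  apply: ler_sum => j _; rewrite !aE mulrCA [_ * a j]mulrC -mulrDr ler_wpM2l//.
  by rewrite -box_heightE; have /andP[] := box_vertex_in R (enum_val j) i.
move=> xP; pose h i := (A i)%:R + (q i)%:~R * x 0 0.
have /andP[x00 x01] : 0 <= x 0 0 <= 1.
  by have := xP 0; rewrite box_heightE q0 A0 mul0r addr0.
have h_gt0 i : 0 < h i.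
  rewrite /h -box_heightE.
  have [x0|x0] := ltP (x 0 0) 1.
    by rewrite ltr_pwDl ?mulr_ge0// mulr_gt0 ?ltr0n ?subr_gt0.
  by rewrite ltr_wpDl ?mulr_ge0 ?subr_ge0// mulr_gt0 ?ltr0n// (lt_le_trans _ x0).
pose y i := x 0 i / h i.
have y01 i : 0 <= y i <= 1.
  have := xP i; rewrite box_heightE -/(h i) => /andP[xi0 xi1].
  by rewrite /y ler_pdivrMr// mul1r xi1 andbT mulr_ge0// invr_ge0 ltW.
pose w (e : {ffun 'I_n.+1 -> bool}) := \prod_i (if e i then y i else 1 - y i).
exists (fun j => w (enum_val j)); split.
- move=> j; apply: prodr_ge0 => i _; have /andP[yi0 yi1] := y01 i.
  by case: ifP; rewrite ?subr_ge0.
- rewrite -(big_enum_val w)/=.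
  rewrite -[RHS](big_pred0_eq 1 *%R (index_enum 'I_n.+1) y).
  by rewrite -sum_bernoulli; apply: eq_bigr => e _; rewrite big_pred0_eq mulr1.
apply/rowP => i; rewrite summxE.
under eq_bigr do rewrite mxE box_vertexE.
rewrite -(big_enum_val (fun e => w e *
  ((e i)%:R * ((A i)%:R + (q i)%:~R * (e 0)%:R))))/=.
have w1 : \sum_e w e * (e i)%:R = y i.
  rewrite -[RHS](big_pred1_eq *%R i y) -sum_bernoulli.
  by apply: eq_bigr => e _; rewrite big_pred1_eq.
have w2 : i != 0 -> \sum_e w e * ((e i)%:R * (e 0)%:R) = y i * y 0.
  move=> i0; have D (F : 'I_n.+1 -> R) :
      \prod_(k | (k == i) || (k == 0)) F k = F i * F 0.
    rewrite (bigD1 i) ?eqxx//= (bigD1 0) ?eqxx ?orbT ?(eq_sym 0)//=.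
    rewrite big1 ?mulr1// => k /andP[/andP[]].
    by case: (k == i) => //= ->.
  by rewrite -D -sum_bernoulli; apply: eq_bigr => e _; rewrite D.
have h0 : h 0 = 1 by rewrite /h q0 A0 mul0r addr0.
have y0 : y 0 = x 0 0 by rewrite /y h0 divr1.
rewrite (eq_bigr (fun e => (A i)%:R * (w e * (e i)%:R) +
  (q i)%:~R * (w e * ((e i)%:R * (e 0)%:R)))); last by move=> e _; ring.
rewrite big_split/= -!mulr_sumr w1.
have [->|i0] := eqVneq i 0; first by rewrite q0 A0 mul0r addr0 mul1r y0.
rewrite w2// y0; have -> : x 0 i = y i * h i by rewrite /y divfK ?gt_eqF.
by rewrite /h; ring.
Qed.

Lemma box_lattice_polytope (R : realType) : lattice_polytope (box R).
Proof. by do 2!eexists; exact: box_conv_hull. Qed.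

(** All heights being at least 1, the box contains the origin and every unit vector. *)
Lemma box_has_dim (R : realType) : has_dim (box R) n.+1.
Proof.
exists 0, fullv; split.
- by move=> i; rewrite !mxE subr0 mulr1 mulr0 addr0 lexx ler0n.
- by move=> x _; rewrite memvf.
- move=> W WP; apply/subvP => x _; rewrite [x]row_sum_delta.
  apply: memv_suml => i _; rewrite memvZ// -[X in X \in _]subr0 WP// => k.
  rewrite !mxE eqxx/=; have [->|i0] := eqVneq i 0.
    rewrite ?eqxx subrr mulr0 mulr1 add0r ler0n/= ler_nat.
    by case: eqP => // _; exact: Cpos.
  rewrite subr0 mulr0 mulr1 addr0 ler0n/= ler_nat.
  by case: eqP => // _; exact: Apos.
- by rewrite dimvf /dim/= mul1n.
Qed.

Section BoxVertex.
Variable e : {ffun 'I_n.+1 -> bool}.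

Let s i : int := (-1) ^+ (e i).

(** Row [i] points from the vertex to the one with bit [i] flipped. For [i != 0] it is a signed unit
    vector; for [i = 0] it must also follow, with slope [q k], each upper facet through the vertex.
    In [box_normals], column [k] is the inner normal of the facet in direction [k] through the
    vertex. *)
Definition box_directions : 'M[int]_n.+1 :=
  \matrix_(i, k) (s i * ((k == i)%:R + (i == 0)%:R * ((e k)%:R * q k))).

Definition box_normals : 'M[int]_n.+1 :=
  \matrix_(l, k) ((l == k)%:R * s k + (l == 0)%:R * ((e k)%:R * q k)).

Lemma box_directionsK : box_directions *m box_normals = 1%:M.
Proof.
apply/matrixP => i k; rewrite !mxE.
under eq_bigr do rewrite !mxE.
rewrite (eq_bigr (fun l => (l == i)%:R *
    (s i * ((l == k)%:R * s k + (l == 0)%:R * ((e k)%:R * q k))) +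
  ((l == k)%:R * (s i * (i == 0)%:R * ((e l)%:R * q l) * s k) +
  (l == 0)%:R * (s i * (i == 0)%:R * ((e l)%:R * q l) * ((e k)%:R * q k)))));
  last by move=> l _; ring.
rewrite !big_split/= !sumr_delta q0 /s.
have [<-|ik] := eqVneq i k; have [i0|i0] := eqVneq i 0; subst=> //=;
  rewrite ?q0; case: (e _) => //=; rewrite ?expr1 ?expr0; try ring.
all: case: (e _) => //=; rewrite ?expr1 ?expr0; ring.
Qed.

(** The dual coordinates at a vertex are the slacks of the facet inequalities tight there, hence
    nonnegative on the box. *)
Lemma box_slack (R : realType) x k :
  ((x - int_point R (box_vertex e)) *m map_mx intr box_normals) 0 k =
  (if e k then (A k)%:R + (q k)%:~R * x 0 0 - x 0 k else x 0 k).
Proof.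
rewrite mxE.
rewrite (eq_bigr (fun l =>
  (l == k)%:R * ((x 0 l - int_point R (box_vertex e) 0 l) * (s k)%:~R) +
  (l == 0)%:R * ((x 0 l - int_point R (box_vertex e) 0 l) * ((e k)%:R * (q k)%:~R))));
  last first.
  move=> l _; set V := int_point R _.
  have -> : (x - V) 0 l = x 0 l - V 0 l by rewrite mxE; congr (_ + _); rewrite mxE.
  by rewrite [map_mx _ box_normals l k]mxE [box_normals l k]mxE; ring.
rewrite big_split/= !sumr_delta box_vertex0 box_vertexE /s.
by case: (e k); rewrite /= ?expr1 ?expr0 ?rmorphN1 ?rmorph1; ring.
Qed.

Lemma box_step (R : realType) i : exists2 t : R, 0 < t &
  box R (int_point R (box_vertex e) + t *: int_point R (row i box_directions)).
Proof.
(* The full length of the edge: the step ends at the neighbouring vertex [e']. *)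
exists ((if e 0 then C i else A i)%:R : R); first by case: (e 0); rewrite ltr0n.
pose e' := [ffun k => e k (+) (k == i)].
suff -> : int_point R (box_vertex e) +
    (if e 0 then C i else A i)%:R *: int_point R (row i box_directions) =
  int_point R (box_vertex e') by exact: box_vertex_in.
apply/rowP => k.
set V := int_point R (box_vertex e); set t := (_%:R : R); set D := int_point R _.
have -> : (V + t *: D) 0 k = V 0 k + t * D 0 k.
  by rewrite mxE; congr (_ + _); rewrite mxE.
have -> : D 0 k =
    (s i)%:~R * ((k == i)%:R + (i == 0)%:R * ((e k)%:R * (q k)%:~R)).
  rewrite [D 0 k]mxE [row _ _ _ _]mxE [box_directions _ _]mxE; ring.
rewrite /t /V !box_vertexE !ffunE /s.
have [i0|i0] := eqVneq i 0.
  subst i; rewrite A0 C0 if_same.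
  have [->|k0] := eqVneq k 0.
    by rewrite q0 A0; case: (e 0); rewrite /= ?expr1 ?expr0 ?rmorphN1 ?rmorph1; ring.
  by case: (e 0); case: (e k); rewrite /= ?expr1 ?expr0 ?rmorphN1 ?rmorph1; ring.
rewrite addbF.
have [->|ki] := eqVneq k i.
  have -> : (if e 0 then C i else A i)%:R = (A i)%:R + (q i)%:~R * (e 0)%:R :> R.
    rewrite -box_heightE.
    by case: (e 0); rewrite /= ?subrr ?subr0 ?mulr0 ?mulr1 ?add0r ?addr0.
  by case: (e i); rewrite /= ?expr1 ?expr0 ?rmorphN1 ?rmorph1; ring.
by rewrite addbF !mul0r addr0 !mulr0 addr0.
Qed.

End BoxVertex.

Lemma box_smooth (R : realType) : smooth (box R).
Proof.
move=> v; rewrite {1}box_conv_hull => /vertex_conv_hull[j ->].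
apply: (unimodular_cone_smooth R n.+1 _ _ _ _ (box_directionsK (enum_val j))).
- exact: box_vertex_in.
- move=> x k xP; rewrite box_slack; have := xP k; rewrite box_heightE => /andP[xk0 xk1].
  by case: ifP => //; rewrite subr_ge0.
- exact: box_step.
Qed.

End Box.

(** * Lattice points of the dilates *)

Lemma card_eq_image_finite (T : finType) (U : Type) (S : {pred T}) (g : T -> U) :
  injective g -> ((g @` [set` S]) #= `I_#|S|)%card.
Proof.
move=> ginj; rewrite (card_eqr card_II).
have -> : g @` [set` S] = range (fun j : 'I_#|S| => g (enum_val j)).
  apply/seteqP; split=> u; last first.
    by case=> j _ <-; exists (enum_val j) => //; exact: enum_valP.
  by case=> x xS <-; exists (enum_rank_in xS x) => //; rewrite enum_rankK_in.
by apply: inj_card_eq => i j _ _ /ginj; exact: enum_val_inj.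
Qed.

Lemma card_ord_leq (M h : nat) : (h <= M)%N -> #|[pred y : 'I_M.+1 | (y <= h)%N]| = h.+1.
Proof.
move=> hM; rewrite -sum1_card -(big_ord_widen _ (fun=> 1%N) (hM : (h.+1 <= M.+1)%N)).
by rewrite sum_nat_const card_ord muln1.
Qed.

Section BoxEhrhart.
Variables (n : nat) (A C : 'I_n.+1 -> nat).
Hypotheses (A0 : A 0 = 1%N) (C0 : C 0 = 1%N).

Lemma dilate_box (R : realType) (t : nat) (x : 'rV[R]_n.+1) : (0 < t)%N ->
  dilate t%:R (box n A C R) x <->
  forall i, 0 <= x 0 i <= (A i)%:R * (t%:R - x 0 0) + (C i)%:R * x 0 0.
Proof.
move=> t0; have tR : 0 < t%:R :> R by rewrite ltr0n.
split=> [[y yP <-] i|xP].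
  rewrite !mxE; have := yP i => /andP[yi0 yi1].
  rewrite mulr_ge0 ?ler0n//=.
  have -> : (A i)%:R * (t%:R - t%:R * y 0 0) + (C i)%:R * (t%:R * y 0 0) =
    t%:R * ((A i)%:R * (1 - y 0 0) + (C i)%:R * y 0 0) by ring.
  by rewrite ler_wpM2l.
exists (t%:R^-1 *: x); last by rewrite scalerA mulfV ?scale1r ?gt_eqF.
move=> i; rewrite !mxE; have := xP i => /andP[xi0 xi1].
rewrite mulr_ge0 ?invr_ge0 ?ler0n//= mulrC ler_pdivrMr//.
apply: le_trans xi1 _; rewrite le_eqVlt; apply/orP; left; apply/eqP.
by field; rewrite gt_eqF.
Qed.

Variable t : nat.

Let H (z : nat) i := (A i * (t - z) + C i * z)%N.
(** A common bound on all coordinates, which turns lattice points into functions between finite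
    types. *)
Let M := ((\sum_i (A i + C i)) * t)%N.

Let HM z i : (z <= t)%N -> (H z i <= M)%N.
Proof.
move=> zt; apply: (@leq_trans ((A i + C i) * t)).
  by rewrite mulnDl leq_add ?leq_mul// leq_subr.
by rewrite leq_mul2r (bigD1 i)//= leq_addr orbT.
Qed.

Let tM : (t <= M)%N.
Proof. by have := HM 0 0 (leq0n t); rewrite /H A0 muln0 addn0 mul1n subn0. Qed.

(** The bound on [f 0] is a separate condition: with truncated subtraction, [H z 0] is the maximum
    of [t] and [z], so [f 0 <= H (f 0) 0] always holds. *)
Let S := [pred f : {ffun 'I_n.+1 -> 'I_M.+1} |
  (f 0%R <= t)%N && [forall i, (f i <= H (f 0%R) i)%N]].

Let card_S :
  #|S| = (\sum_(z < t.+1) \prod_(i | i != 0%R) (H z i).+1)%N.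
Proof.
rewrite (big_ord_widen M.+1 (fun z : nat => \prod_(i | i != 0%R) (H z i).+1)%N) ?ltnS//.
rewrite -sum1_card (partition_big (fun f : {ffun _ -> _} => f 0)
  (fun z : 'I_M.+1 => (z < t.+1)%N))/=; last by move=> f /andP[].
apply: eq_bigr => z; rewrite ltnS => zt.
(* The slice at [z] is a product of intervals, with direction 0 pinned to [z]. *)
pose F i : pred 'I_M.+1 := if i == 0 then pred1 z else [pred y : 'I_M.+1 | (y <= H z i)%N].
rewrite (eq_bigl (fun f => f \in family F)); last first.
  move=> f; apply/andP/familyP => [[/andP[_ /forallP fH] /eqP fz] i|fF].
    rewrite /F; case: eqP => [->|_]; first by rewrite inE fz.
    by rewrite inE -fz.
  have fz : f 0 = z by have := fF 0; rewrite /F eqxx inE => /eqP.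
  split; last by rewrite fz.
  apply/andP; rewrite fz; split=> //; apply/forallP => i; have := fF i.
  rewrite /F; case: eqP => [->|_]; last by rewrite inE.
  by rewrite fz /H A0 C0 !mul1n subnK.
rewrite sum1_card card_family foldrE big_image/= (bigD1 0)//= {1}/F eqxx card1 mul1n.
apply: eq_bigr => i /negPf i0; rewrite /F i0; exact/card_ord_leq/HM.
Qed.

Lemma card_lattice_points_box (R : realType) : (0 < t)%N ->
  (lattice_points (dilate t%:R (box n A C R)) #=
    `I_(\sum_(z < t.+1) \prod_(i | i != 0%R) (A i * (t - z) + C i * z).+1))%card.
Proof.
move=> t0; pose g (f : {ffun 'I_n.+1 -> 'I_M.+1}) : 'rV[int]_n.+1 :=
  \row_i (f i : nat)%:Z.
have ginj : injective g.
  move=> f1 f2 /rowP fE; apply/ffunP => i; apply/val_inj.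
  by have := fE i; rewrite !mxE => -[].
rewrite -card_S.
suff -> : lattice_points (dilate t%:R (box n A C R)) = g @` [set` S].
  exact: card_eq_image_finite.
have leE (k : 'I_n.+1 -> nat) i : (k 0%R <= t)%N ->
    ((k i)%:R <= (A i)%:R * (t%:R - (k 0)%:R) + (C i)%:R * (k 0)%:R :> R) =
    (k i <= H (k 0%R) i)%N.
  by move=> kt; rewrite -natrB// -!natrM -natrD ler_nat.
apply/seteqP; split=> z.
  rewrite /lattice_points /= => /(dilate_box _ _ _ t0) zP.
  pose k i := absz (z 0 i).
  have zk i : z 0 i = k i.
    by rewrite /k gez0_abs//; have := zP i; rewrite mxE ler0z => /andP[].
  have zR i : int_point R z 0 i = (k i)%:R by rewrite mxE zk.
  have k0 : (k 0%R <= t)%N.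
    have := zP 0; rewrite !zR A0 C0 !mul1r subrK => /andP[_].
    by rewrite ler_nat.
  have kH i : (k i <= H (k 0%R) i)%N.
    by rewrite -leE//; have := zP i; rewrite !zR => /andP[].
  have fk i : (inord (k i) : 'I_M.+1) = k i :> nat.
    by rewrite inordK// ltnS (leq_trans (kH i))// HM.
  exists [ffun i => inord (k i)].
    by rewrite /= inE ffunE fk k0; apply/forallP => i; rewrite ffunE fk.
  by apply/rowP => i; rewrite mxE ffunE fk zk.
case=> f; rewrite /= inE => /andP[f0 /forallP fH] <-.
apply/(dilate_box _ _ _ t0) => i; rewrite !mxE.
by rewrite (leE (fun i => f i : nat))// ler0n fH.
Qed.

End BoxEhrhart.

(** * The Ehrhart polynomial and the signs of its coefficients *)

Lemma bin_le_exp2 (m k : nat) : ('C(m, k) <= 2 ^ m)%N.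
Proof.
elim: m k => [|m IH] [|k] //; first by rewrite bin0 expn_gt0.
by rewrite binS expnS mul2n -addnn leq_add.
Qed.

Lemma coef_linear_exp (R : comNzRingType) (b : R) (m k : nat) :
  ((1 + b *: 'X) ^+ m : {poly R})`_k = b ^+ k *+ 'C(m, k).
Proof.
rewrite addrC exprD1n coef_sum.
under eq_bigr do rewrite coefMn exprZn coefZ coefXn.
have [km|mk] := leqP k m.
  rewrite (bigD1 (Ordinal (km : (k < m.+1)%N)))//= eqxx mulr1 big1 ?addr0// => i.
  by rewrite -val_eqE/= eq_sym => /negPf ->; rewrite mulr0 mul0rn.
rewrite bin_small// mulr0n big1// => i _.
by rewrite gtn_eqF ?mulr0 ?mul0rn// (leq_trans (ltn_ord i)).
Qed.

Lemma size_linear_exp (R : comNzRingType) (b : R) (m : nat) :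
  (size ((1 + b *: 'X) ^+ m : {poly R}) <= m.+1)%N.
Proof.
by apply/leq_sizeP => j mj; rewrite coef_linear_exp bin_small// mulr0n.
Qed.

Lemma sum_quadratic (R : realFieldType) (a c : R) (t : nat) :
  \sum_(z < t.+1) (a + c * (z%:R * (t%:R - z%:R))) =
  a * (t%:R + 1) + c * ((t%:R ^+ 3 - t%:R) / 6).
Proof.
(* The parameter [u] is kept apart from the number of terms, since every summand depends on [t]. *)
have S (u : R) k : \sum_(z < k) (a + c * (z%:R * (u - z%:R))) =
    a * k%:R + c * (u * (k%:R * (k%:R - 1) / 2) -
                    k%:R * (k%:R - 1) * (2 * k%:R - 1) / 6).
  elim: k => [|k IH]; first by rewrite big_ord0; field.
  by rewrite big_ord_recr/= IH -natr1; field.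
by rewrite S -natr1; field.
Qed.

Section Witness.
Variables (m b : nat).

(** The default value of [nth] supplies the side [b] in all directions from 3 on. *)
Definition lower_height (i : 'I_m.+3) : nat :=
  nth b [:: 1; (6 * b).+1; 1]%N i.
Definition upper_height (i : 'I_m.+3) : nat :=
  nth b [:: 1; 1; (6 * b).+1]%N i.

(** With [d = 6 b] the cubic factor is [(t+1)^3 + d t (t+1)^2 + d^2 (t^3 - t) / 6], expanded. *)
Definition ehrhart_box (R : realType) : {poly R} :=
  (1 + b%:R *: 'X) ^+ m *
  (1 + (3 + 6 * b%:R - 6 * b%:R ^+ 2) *: 'X + (3 + 12 * b%:R) *: 'X^2 +
   (1 + 6 * b%:R + 6 * b%:R ^+ 2) *: 'X^3).

Lemma ehrhart_boxE (R : realType) (t : nat) : (ehrhart_box R).[t%:R] =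
  (\sum_(z < t.+1) \prod_(i | i != 0%R)
     (lower_height i * (t - z) + upper_height i * z).+1)%:R.
Proof.
rewrite natr_sum.
(* With [u = t - z] and [d = 6 b], the two special directions contribute [(t+1 + d u) (t+1 + d z) =
   (t+1)^2 + d t (t+1) + d^2 z u]. *)
rewrite (eq_bigr (fun z : 'I_t.+1 => (1 + b%:R * t%:R) ^+ m *
   (((t%:R + 1) ^+ 2 + 6 * b%:R * t%:R * (t%:R + 1)) +
    36 * b%:R ^+ 2 * (z%:R * (t%:R - z%:R))))); last first.
  move=> z _; have zt : (z <= t)%N by rewrite -ltnS.
  move: {z}(z : nat) zt => z zt; rewrite -(subnK zt) addnK.
  move: (t - z)%N => u {t zt}.
  rewrite big_mkcond !big_ord_recl /lower_height /upper_height.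
  have [d dE] : exists d, d = (6 * b)%N by exists (6 * b)%N.
  rewrite -dE /=.
  rewrite (eq_bigr (fun=> (b * (u + z)).+1)); last first.
    by move=> i _; rewrite nth_nil mulnDr.
  rewrite big_const_ord iter_muln_1 dE !natrM natrX.
  have -> : (b * (u + z)).+1%:R = 1 + b%:R * (u + z)%:R :> R by ring.
  by move: (_ ^+ m) => X; ring.
rewrite -mulr_sumr sum_quadratic /ehrhart_box hornerM horner_exp.
rewrite !hornerD !hornerZ hornerX !hornerXn -polyC1 !hornerC.
by congr (_ * _); field.
Qed.

Lemma size_ehrhart_box (R : realType) : (size (ehrhart_box R) <= m.+4)%N.
Proof.
apply: leq_trans (size_polyMleq _ _) _.
set p := (X in (_ + size X)%N).
have : (size p <= 4)%N.
  apply/leq_sizeP => j j4; rewrite !coefD !coefZ coef1 coefX !coefXn.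
  by case: j j4 => [|[|[|[|j]]]]//= _; rewrite !mulr0 !addr0.
move=> sp; rewrite -subn1 leq_subLR (leq_trans (leq_add (size_linear_exp _ _ _) sp))//.
by rewrite addnC.
Qed.

Lemma coef_ehrhart_box_lt0 (R : realType) (j : nat) :
  b = (2 ^ m.+3)%N -> (1 <= j <= m.+1)%N -> (ehrhart_box R)`_j < 0.
Proof.
move=> bE; case: j => // j; rewrite ltnS => /= jm.
pose K : R := (2 ^ m)%:R; pose B : R := b%:R.
have K1 : 1 <= K by rewrite ler1n expn_gt0.
have BK : B = 8 * K by rewrite /B bE !expnS !mulnA natrM.
have B0 : 0 < B by lra.
have Xj0 : 0 < B ^+ j by rewrite exprn_gt0.
have le k : B ^+ k *+ 'C(m, k) <= K * B ^+ k.
  by rewrite -mulr_natr mulrC ler_wpM2r ?exprn_ge0 ?(ltW B0)// ler_nat bin_le_exp2.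
(* Here [j] is the degree minus one. The degree bound enters as [j <= m], which makes this binomial
   coefficient nonzero. *)
have ge : B ^+ j <= B ^+ j *+ 'C(m, j).
  by rewrite -mulr_natr ler_peMr ?(ltW Xj0)// ler1n bin_gt0.
have le_shift r : B ^+ r *
    (if (j.+1 < r.+1)%N then 0 else B ^+ (j.+1 - r.+1) *+ 'C(m, j.+1 - r.+1)) <=
    K * B ^+ j.
  rewrite subSS ltnS; case: leqP => [rj|_]; last first.
    by rewrite mulr0 mulr_ge0 ?ler0n// ltW.
  rewrite -(subnKC rj) [in leRHS]exprD addKn mulrCA.
  by rewrite ler_wpM2l ?le ?exprn_ge0 ?(ltW B0).
move: (le j.+1) (le_shift 1%N) (le_shift 2%N).
rewrite /ehrhart_box !mulrDr mulr1 -!scalerAr !coefD !coefZ coefMX !coefMXn.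
rewrite !coef_linear_exp -/B /= expr1 exprS.
(* From here [u], [w], [y], [v] stand for the coefficients of [(1 + b X)^m] in degrees [j+1], [j],
   [j-1], [j-2], taken as 0 in negative degree. Only [w] gets a lower bound, its factor being
   negative. *)
move: (B ^+ j) Xj0 ge => X X0; move: (X *+ _) => w Xw.
move: (_ *+ _) => u; move: (if _ then _ else _) => y.
move: (if _ then _ else _) => v uX yX vX.
have K0 : 0 < K by lra.
have y8 : y <= X / 8.
  by rewrite ler_pdivlMr// mulrC -(ler_pM2l K0); move: yX; rewrite BK; lra.
have v8 : 8 * B * v <= X.
  by rewrite -(ler_pM2l K0); apply: le_trans vX; rewrite BK expr2; lra.
(* Writing [X = 8 B z] clears denominators: the four bounds add up to [z] times the cubic in [neg],
   which is negative because [B >= 8]. *)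
pose z := X / (8 * B).
have z0 : 0 < z by rewrite divr_gt0 ?mulr_gt0.
have Xz : X = 8 * B * z by rewrite /z; field; rewrite gt_eqF.
have vz : v <= z by rewrite ler_pdivlMr ?mulr_gt0// mulrC.
have B8 : 8 <= B by lra.
have B2 : 8 * B <= B ^+ 2 by rewrite expr2 ler_wpM2r// ltW.
have B3 : 8 * B ^+ 2 <= B ^+ 3 by rewrite [leRHS]exprS ler_wpM2r// exprn_ge0// ltW.
have hu : u <= B / 8 * (B * X) by have -> : B / 8 = K by rewrite BK; field.
have hw : (3 + 6 * B - 6 * B ^+ 2) * w <= (3 + 6 * B - 6 * B ^+ 2) * X.
  by rewrite ler_wnM2l//; lra.
have hy : (3 + 12 * B) * y <= (3 + 12 * B) * (X / 8).
  by rewrite ler_wpM2l// addr_ge0 ?mulr_ge0// ltW.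
have hv : (1 + 6 * B + 6 * B ^+ 2) * v <= (1 + 6 * B + 6 * B ^+ 2) * z.
  by rewrite ler_wpM2l//; lra.
have neg : 1 + 33 * B + 66 * B ^+ 2 - 47 * B ^+ 3 < 0 by lra.
have := nmulr_llt0 z neg; rewrite z0; move: hu hw hy hv; rewrite Xz.
lra.
Qed.

End Witness.

Theorem theorem1p2 (R : realType) (n : nat) (hn : (3 <= n)%N) :
  exists P : set 'rV[R]_n,
    [/\ lattice_polytope P, has_dim P n, smooth P
      & exists c : nat -> R,
          is_ehrhart_poly P (\poly_(j < n.+1) c j) /\
          forall j : nat, (1 <= j <= n - 2)%N -> c j < 0].
Proof.
case: n hn => [|[|[|m]]]// _; pose b := (2 ^ m.+3)%N.
have b0 : (0 < b)%N by rewrite expn_gt0.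
have lower0 : lower_height m b 0 = 1%N by [].
have upper0 : upper_height m b 0 = 1%N by [].
have lower_gt0 i : (0 < lower_height m b i)%N.
  by rewrite /lower_height; case: i => -[|[|[|i]]] i_lt //=; rewrite nth_nil.
have upper_gt0 i : (0 < upper_height m b i)%N.
  by rewrite /upper_height; case: i => -[|[|[|i]]] i_lt //=; rewrite nth_nil.
exists (box m.+2 (lower_height m b) (upper_height m b) R); split.
- exact: box_lattice_polytope.
- exact: box_has_dim.
- exact: box_smooth.
exists (fun j => (ehrhart_box m b R)`_j); split=> [t t0|j].
  eexists; first exact: card_lattice_points_box.
  rewrite -ehrhart_boxE; congr (_.[_]); apply/polyP => k; rewrite coef_poly.
  by case: ltnP => // mk; rewrite nth_default// (leq_trans (size_ehrhart_box m b R)).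
by rewrite subSS subSS subn0; apply: coef_ehrhart_box_lt0.
Qed.
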